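(* Let $W=W(A,\alpha,u)$ be a generalized Weyl algebra, with $u$ central and regular in $A$, such that, for some fixed positive integer $m$: (i) $Au+A\alpha^i(u)=A$ for all positive integers $i\neq m$; (ii) $M:=Au+A\alpha^m(u)$ is a maximal ideal in $A$. Then the ideal $J(M)$ is a maximal ideal of $W$ containing both $X^m$ and $Y^m$, and is the unique prime ideal $P$ in $W$ for which there exists a positive integer $r$ such that $X^r\in P$ and $Y^r\in P$. Moreover, if $A$ is $\alpha$-simple and no (positive) power of $\alpha$ is inner then $J(M)$ is the unique non-zero prime ideal in $W$.
   Context: Given a ring $A$ (associative with $1$), an automorphism $\alpha$ of $A$ and a central element $u\in A$, the generalized Weyl algebra $W(A,\alpha,u)$ is the ring extension of $A$ generated by $X$ and $Y$ subject to the relations $YX=\alpha(u)$, $XY=u$ and, for all $a\in A$, $Ya=\alpha(a)Y$ and $Xa=\alpha^{-1}(a)X$. It is $\mathbb{Z}$-graded with degree $0$ component $A$ and, for $i>0$, degree $i$ component $AY^i$ and degree $-i$ component $AX^i$, each free of rank one as a left $A$-module. $J(M)$ denotes the $\mathbb{Z}$-graded ideal $J=\bigoplus_{i\in\mathbb{Z}}J_i$ of $W$ with, for $i\geq0$, $J_i=I_iY^i$ and $J_{-i}=I_{-i}X^i$, where $I_i=I_{-i}=A$ if $i\geq m$, and $I_i=\bigcap_{\ell=0}^{m-1-i}\alpha^{-\ell}(M)$, $I_{-i}=\bigcap_{\ell=i}^{m-1}\alpha^{-\ell}(M)$ if $0\leq i\leq m-1$ (this is indeed an ideal of $W$). $A$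 is $\alpha$-simple if $A\ne 0$ and its only ideals $I$ with $\alpha(I)=I$ are $0$ and $A$. An automorphism of $A$ is inner if it has the form $a\mapsto cac^{-1}$ for a unit $c\in A$. *)

(* Defs.v *)
From mathcomp Require Import all_boot all_order all_algebra.
From mathcomp Require Import boolp classical_sets.

Set Implicit Arguments.
Unset Strict Implicit.
Unset Printing Implicit Defensive.

Import GRing.Theory.
Local Open Scope classical_set_scope.
Local Open Scope ring_scope.

(* Rings are associative and unital but neither assumed commutative nor
   non-zero ([pzRingType]); ideals are two-sided, given as [set R]. *)

Definition ideal (R : pzRingType) (I : set R) : Prop :=
  [/\ I 0, (forall x y, I x -> I y -> I (x + y)),
      (forall r x, I x -> I (r * x)) & (forall r x, I x -> I (x * r))].

Definition maximal_ideal (R : pzRingType) (I : set R) : Prop :=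
  [/\ ideal I, I <> setT &
      forall K : set R, ideal K -> I `<=` K -> K = I \/ K = setT].

(* [P] is closed under sums, so the hypothesis on [x * y] says that the
   product ideal [I K] is contained in [P]. *)
Definition prime_ideal (R : pzRingType) (P : set R) : Prop :=
  [/\ ideal P, P <> setT &
      forall I K : set R, ideal I -> ideal K ->
        (forall x y, I x -> K y -> P (x * y)) -> I `<=` P \/ K `<=` P].

Definition central (R : pzRingType) (u : R) : Prop :=
  forall a : R, a * u = u * a.

Definition regular (R : pzRingType) (u : R) : Prop :=
  GRing.lreg u /\ GRing.rreg u.

(* R u + R v *)
Definition lspan2 (R : pzRingType) (u v : R) : set R :=
  [set x | exists a b : R, x = a * u + b * v].

Definition inner (R : pzRingType) (f : R -> R) : Prop :=
  exists c d : R, [/\ c * d = 1, d * c = 1 & forall a, f a = c * a * d].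

Definition alpha_simple (A : pzRingType) (alpha : A -> A) : Prop :=
  (1 : A) <> 0 /\
  forall I : set A, ideal I -> alpha @` I = I -> I = [set 0] \/ I = setT.

(* In what follows [alphaV] stands for the inverse of [alpha]. *)
Definition gwa_relations (A B : pzRingType) (alpha alphaV : A -> A) (u : A)
    (f : A -> B) (x y : B) : Prop :=
  [/\ y * x = f (alpha u), x * y = f u,
      (forall a, y * f a = f (alpha a) * y) &
      (forall a, x * f a = f (alphaV a) * x)].

(* [W], with structure map [iota] and elements [X], [Y], is the generalized
   Weyl algebra W(A, alpha, u): the ring generated over [A] by [X] and [Y]
   subject to the relations, i.e. the initial such ring. Injectivity of
   [iota] and freeness of the graded components are consequences (for [u]
   central and [alpha] an automorphism), not part of the definition. *)
Definition is_gwa (A : pzRingType) (alpha alphaV : A -> A) (u : A)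
    (W : pzRingType) (iota : {rmorphism A -> W}) (X Y : W) : Prop :=
  gwa_relations alpha alphaV u iota X Y /\
  forall (B : pzRingType) (f : {rmorphism A -> B}) (x y : B),
    gwa_relations alpha alphaV u f x y ->
    exists phi : {rmorphism W -> B},
      [/\ (forall a, phi (iota a) = f a), phi X = x, phi Y = y &
          forall psi : {rmorphism W -> B},
            (forall a, psi (iota a) = f a) -> psi X = x -> psi Y = y ->
            psi =1 phi].

(* The coefficient sets I_i ([J_coefY]) and I_{-i} ([J_coefX]), i >= 0; they
   agree at i = 0. *)
Definition J_coefY (A : pzRingType) (alphaV : A -> A) (m : nat) (M : set A)
    (i : nat) : set A :=
  if (m <= i)%N then setT
  else \bigcap_(l in [set l | (l <= m - 1 - i)%N]) (iter l alphaV @` M).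

Definition J_coefX (A : pzRingType) (alphaV : A -> A) (m : nat) (M : set A)
    (i : nat) : set A :=
  if (m <= i)%N then setT
  else \bigcap_(l in [set l | (i <= l <= m - 1)%N]) (iter l alphaV @` M).

(* The sum over all degrees of the components I_i Y^i and I_{-i} X^i; degree 0
   is taken care of by the first sum. *)
Definition J_ideal (A : pzRingType) (alphaV : A -> A) (W : pzRingType)
    (iota : A -> W) (X Y : W) (m : nat) (M : set A) : set W :=
  [set w | exists (n : nat) (a b : nat -> A),
     [/\ forall i, J_coefY alphaV m M i (a i),
         forall i, J_coefX alphaV m M i (b i) &
         w = \sum_(0 <= i < n) iota (a i) * Y ^+ i
           + \sum_(1 <= i < n) iota (b i) * X ^+ i]].

(* Main.v *)
Require Import Defs.
From HB Require Import structures.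
From mathcomp Require Import all_boot all_order all_algebra.
From mathcomp Require Import boolp classical_sets functions zify.

Set Implicit Arguments.
Unset Strict Implicit.
Unset Printing Implicit Defensive.

Import GRing.Theory.
Local Open Scope classical_set_scope.
Local Open Scope ring_scope.

(* Letting W act on its basis ..., X^2, X, 1, Y, Y^2, ... shows that the degree
   zero component of W is a copy of A, so J(M) is proper and non-zero.

   Let K be an ideal containing Y^r. As X Y^r = u Y^(r-1) and
   Y^r X = alpha^r(u) Y^(r-1), comaximality gives Y^(r-1) in K unless r = m;
   likewise for X. Hence K contains Y^m and X^m, and continuing the descent
   with coefficients below degree m shows that K contains J(M).

   Conversely let K be a proper ideal containing J(M) and w in K have a
   homogeneous component outside J(M). Multiplying w by suitable powers of Y on
   both sides moves the lowest such component to degree m - 1 and all higher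
   ones to degrees at least m, so that c Y^(m-1) is in K for some c outside M;
   as M is maximal, Y^(m-1) is in K, and the descent gives 1 in K.

   If A is alpha-simple and no power of alpha is inner, take in a non-zero
   ideal K a non-zero polynomial in Y spread over the fewest degrees. By
   alpha-simplicity its lowest coefficient may be taken to be 1; commutators
   with A and Y then vanish, so a further term e Y^n would have e a unit with
   r e = e alpha^n(r), making alpha^n inner. Hence K contains a power of Y, and
   by symmetry a power of X. *)

(** * Endomorphism rings and subrings *)

Section EndomorphismRing.
Variable V : zmodType.

(** Additive endomorphisms under composition form the ring in which [W] is represented through its
    universal property. *)
Record endo := Endo {
  endo_fun :> V -> V;
  endoD : forall x y, endo_fun (x + y) = endo_fun x + endo_fun y }.

Lemma endo_ext (f g : endo) : f =1 g -> f = g.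
Proof.
case: f g => [f fD] [g gD] /= /funext eqfg; rewrite -eqfg in gD *.
by congr Endo; apply: Prop_irrelevance.
Qed.

HB.instance Definition _ := gen_eqMixin endo.
HB.instance Definition _ := gen_choiceMixin endo.

Fact endo_zero_subproof (x y : V) : 0 = 0 + 0 :> V.
Proof. by rewrite addr0. Qed.
Definition endo_zero := Endo endo_zero_subproof.

Fact endo_opp_subproof (f : endo) (x y : V) : - f (x + y) = - f x + - f y.
Proof. by rewrite endoD opprD. Qed.
Definition endo_opp f := Endo (endo_opp_subproof f).

Fact endo_add_subproof (f g : endo) (x y : V) :
  f (x + y) + g (x + y) = (f x + g x) + (f y + g y).
Proof. by rewrite !endoD addrACA. Qed.
Definition endo_add f g := Endo (endo_add_subproof f g).

Definition endo_one := @Endo id (fun x y => erefl).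

Fact endo_mul_subproof (f g : endo) (x y : V) :
  f (g (x + y)) = f (g x) + f (g y).
Proof. by rewrite !endoD. Qed.
Definition endo_mul f g := Endo (endo_mul_subproof f g).

Fact endo_addA : associative endo_add.
Proof. by move=> f g h; apply: endo_ext => x /=; rewrite addrA. Qed.
Fact endo_addC : commutative endo_add.
Proof. by move=> f g; apply: endo_ext => x /=; rewrite addrC. Qed.
Fact endo_add0 : left_id endo_zero endo_add.
Proof. by move=> f; apply: endo_ext => x /=; rewrite add0r. Qed.
Fact endo_addN : left_inverse endo_zero endo_opp endo_add.
Proof. by move=> f; apply: endo_ext => x /=; rewrite addNr. Qed.
Fact endo_mulA : associative endo_mul.
Proof. by move=> f g h; apply: endo_ext. Qed.
Fact endo_mul1r : left_id endo_one endo_mul.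
Proof. by move=> f; apply: endo_ext. Qed.
Fact endo_mulr1 : right_id endo_one endo_mul.
Proof. by move=> f; apply: endo_ext. Qed.
Fact endo_mulDl : left_distributive endo_mul endo_add.
Proof. by move=> f g h; apply: endo_ext. Qed.
Fact endo_mulDr : right_distributive endo_mul endo_add.
Proof. by move=> f g h; apply: endo_ext => x /=; rewrite endoD. Qed.

HB.instance Definition _ := GRing.isPzRing.Build endo
  endo_addA endo_addC endo_add0 endo_addN endo_mulA endo_mul1r endo_mulr1
  endo_mulDl endo_mulDr.

End EndomorphismRing.

Section Subring.
Variables (W : pzRingType) (S : {pred W}).
Hypothesis closedS : GRing.subring_closed S.

(* The proof is an argument so that instance inference can find closedness. *)
Definition subring_pred (_ : GRing.subring_closed S) : W -> bool :=
  fun x => x \in S.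

HB.instance Definition _ :=
  GRing.isSubringClosed.Build W (subring_pred closedS) closedS.

Definition subring := {x : W | subring_pred closedS x}.
HB.instance Definition _ := [isSub of subring for sval].
HB.instance Definition _ := [Choice of subring by <:].
HB.instance Definition _ := GRing.SubChoice_isSubPzRing.Build W
  (subring_pred closedS) subring (GRing.subringClosedP _).

End Subring.

(** * Iterates of ring endomorphisms; central and regular elements *)

Section RingMorphismFacts.
Variable A : pzRingType.
Implicit Types (f g : {rmorphism A -> A}) (a b : A) (i j : nat).

Lemma rmorph_inverse f (fV : A -> A) : cancel f fV -> cancel fV f ->
  exists g, fV = g.
Proof.
move=> fK fVK.
pose aM := GRing.isZmodMorphism.Build A A fV (can2_zmod_morphism fK fVK).
pose mM := GRing.isMonoidMorphism.Build A A fV (can2_monoid_morphism fK fVK).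
pose g : {rmorphism A -> A} := HB.pack fV aM mM.
by exists g.
Qed.

Lemma iter_rmorphism f i : exists g, iter i f = g.
Proof.
elim: i => [|i [g Eg]]; first by exists idfun; apply: funext.
by exists (f \o g); apply: funext => a /=; rewrite Eg.
Qed.

Lemma iter_rmorphM f i : {morph iter i f : a b / a * b}.
Proof. by have [g ->] := iter_rmorphism f i; apply: rmorphM. Qed.

Lemma iter_rmorphD f i : {morph iter i f : a b / a + b}.
Proof. by have [g ->] := iter_rmorphism f i; apply: rmorphD. Qed.

Lemma iter_rmorph0 f i : iter i f 0 = 0.
Proof. by have [g ->] := iter_rmorphism f i; apply: rmorph0. Qed.

Lemma iter_rmorph1 f i : iter i f 1 = 1.
Proof. by have [g ->] := iter_rmorphism f i; apply: rmorph1. Qed.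

Lemma iter_can f g i : cancel f g -> cancel (iter i f) (iter i g).
Proof. by move=> fK a; elim: i a => //= i IH a; rewrite -iterS iterSr fK IH. Qed.

Lemma central_can f g a : cancel g f -> central a -> central (f a).
Proof. by move=> gK ca b; rewrite -[b]gK -!rmorphM ca. Qed.

Lemma central_iter f g i a : cancel g f -> central a -> central (iter i f a).
Proof. by move=> gK ca; elim: i => //= i; apply: central_can. Qed.

Lemma regular_can f g a : cancel f g -> cancel g f -> regular a ->
  regular (f a).
Proof.
move=> fK gK [la ra]; split=> b c /(congr1 g); rewrite !rmorphM !fK.
  by move=> /la /(can_inj gK).
by move=> /ra /(can_inj gK).
Qed.

End RingMorphismFacts.

(** * The universal property and the degree zero component *)

Section Relations.
Variables (A : pzRingType) (alpha alphaV : {rmorphism A -> A}).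
Hypotheses (alphaK : cancel alpha alphaV) (alphaVK : cancel alphaV alpha).

(** This symmetry between [X] and [Y] lets the descent and the alpha-simple argument be carried out
    for powers of [Y] only. *)
Lemma gwa_relations_sym (u : A) (B : pzRingType) (f : A -> B) (x y : B) :
  gwa_relations alphaV alpha (alpha u) f y x <->
  gwa_relations alpha alphaV u f x y.
Proof. by rewrite /gwa_relations alphaK; split=> -[]. Qed.

Lemma is_gwa_sym (u : A) (W : pzRingType) (iota : {rmorphism A -> W})
    (X Y : W) :
  is_gwa alpha alphaV u iota X Y -> is_gwa alphaV alpha (alpha u) iota Y X.
Proof.
case=> rel univ; split=> [|B f y x /gwa_relations_sym/univ].
  exact/gwa_relations_sym.
case=> phi [? ? ? uphi]; exists phi; split=> // psi ? ? ?; exact: uphi.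
Qed.

(* The ring homomorphism from [W] to a subring containing the generators,
   followed by the inclusion, is the identity of [W]. *)
Lemma gwa_generated (u : A) (W : pzRingType) (iota : {rmorphism A -> W})
    (X Y : W) (S : set W) :
  is_gwa alpha alphaV u iota X Y ->
  S 1 -> (forall v w, S v -> S w -> S (v - w)) ->
  (forall v w, S v -> S w -> S (v * w)) ->
  (forall a, S (iota a)) -> S X -> S Y -> forall w, S w.
Proof.
move=> [rel univ] S1 SB SM Siota SX SY w.
pose SP : {pred W} := fun w => `[< S w >].
have clS : GRing.subring_closed SP.
  split; first exact/asboolP.
    by move=> v z /asboolP Sv /asboolP Sz; apply/asboolP/SB.
  by move=> v z /asboolP Sv /asboolP Sz; apply/asboolP/SM.
pose inS v (Sv : S v) : subring clS := exist _ v (asboolT Sv).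
pose f a := inS _ (Siota a).
have fZ : zmod_morphism f by move=> a b; apply: val_inj; rewrite /= rmorphB.
have fM : monoid_morphism f.
  by split=> [|a b]; apply: val_inj; rewrite /= (rmorph1, rmorphM).
pose f' : {rmorphism A -> subring clS} := HB.pack f
  (GRing.isZmodMorphism.Build _ _ f fZ) (GRing.isMonoidMorphism.Build _ _ f fM).
have [YX XY Ya Xa] := rel.
have [|phi [phia phiX phiY _]] := univ (subring clS) f' (inS _ SX) (inS _ SY).
  by split=> *; apply: val_inj => /=.
have [id' [_ _ _ uid]] := univ W iota X Y rel.
pose incl : {rmorphism subring clS -> W} := val.
have idw : w = id' w by apply: (uid (idfun : {rmorphism W -> W})).
have inclw : (incl \o phi : {rmorphism W -> W}) w = id' w.
  apply: uid; first by move=> a; exact: (congr1 val (phia a)).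
    exact: (congr1 val phiX).
  exact: (congr1 val phiY).
have -> : w = incl (phi w) by rewrite [LHS]idw -inclw.
exact/asboolP/(valP (phi w)).
Qed.

Section Representation.
Variables (u : A) (u_central : central u).

(* The left regular representation of [W] on its basis
   ..., X^2, X, 1, Y, Y^2, ..., here indexed by the degree. *)
Let V := int -> A.

Fact gwa_scale_subproof (a : A) (g h : V) :
  (fun j => a * (g + h) j) = (fun j => a * g j) + (fun j => a * h j).
Proof. by apply: funext => j; rewrite -mulrDr. Qed.
Definition gwa_scale a : endo V := Endo (gwa_scale_subproof a).

(** The factor [alpha u] appears when the target degree is at most 0, because Y X^i = alpha(u)
    X^(i-1). *)
Fact gwa_Y_subproof (g h : V) :
  (fun j : int => alpha ((g + h) (j - 1)) * (if 1 <= j then 1 else alpha u)) =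
  (fun j => alpha (g (j - 1)) * (if 1 <= j then 1 else alpha u)) +
  (fun j => alpha (h (j - 1)) * (if 1 <= j then 1 else alpha u)).
Proof.
by apply: funext => j; rewrite [alpha _](rmorphD _ (g (j - 1))) mulrDl.
Qed.
Definition gwa_Y : endo V := Endo gwa_Y_subproof.

(** The factor [u] appears when the target degree is at least 0, because X Y^i = u Y^(i-1). *)
Fact gwa_X_subproof (g h : V) :
  (fun j : int => alphaV ((g + h) (j + 1)) * (if j < 0 then 1 else u)) =
  (fun j => alphaV (g (j + 1)) * (if j < 0 then 1 else u)) +
  (fun j => alphaV (h (j + 1)) * (if j < 0 then 1 else u)).
Proof.
by apply: funext => j; rewrite [alphaV _](rmorphD _ (g (j + 1))) mulrDl.
Qed.
Definition gwa_X : endo V := Endo gwa_X_subproof.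

Lemma gwa_scale_zmod_morphism : zmod_morphism gwa_scale.
Proof.
by move=> a b; apply: endo_ext => g; apply: funext => j; rewrite /= mulrBl.
Qed.

Lemma gwa_scale_monoid_morphism : monoid_morphism gwa_scale.
Proof.
split=> [|a b]; apply: endo_ext => g; apply: funext => j /=.
  by rewrite mul1r.
by rewrite mulrA.
Qed.

HB.instance Definition _ :=
  GRing.isZmodMorphism.Build A (endo V) gwa_scale gwa_scale_zmod_morphism.
HB.instance Definition _ :=
  GRing.isMonoidMorphism.Build A (endo V) gwa_scale gwa_scale_monoid_morphism.

Lemma gwa_representation :
  gwa_relations alpha alphaV u gwa_scale gwa_X gwa_Y.
Proof.
have au_central := central_can alphaVK u_central.
split; [| | move=> a..]; apply: endo_ext => g; apply: funext => j /=.
(* The two case distinctions are complementary, so exactly one factor [alpha u] arises in each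
   degree. *)
- rewrite subrK rmorphM alphaVK (_ : (j - 1 < 0) = ~~ (1 <= j)); last by lia.
  by rewrite -au_central; case: (1 <= j); rewrite /= ?rmorph1 ?mulr1.
- rewrite addrK rmorphM alphaK (_ : (1 <= j + 1) = ~~ (j < 0)); last by lia.
  by rewrite -u_central; case: (j < 0); rewrite /= ?rmorph1 ?alphaK ?mulr1.
- by rewrite rmorphM mulrA.
- by rewrite rmorphM mulrA.
Qed.

(** Applying the image of w to the basis vector 1, which is [delta 0], and reading entry 0 gives the
    degree zero coefficient of w. In particular [iota] is injective. *)
Lemma gwa_degree0 (W : pzRingType) (iota : {rmorphism A -> W}) (X Y : W) :
  is_gwa alpha alphaV u iota X Y ->
  exists c0 : W -> A, [/\ {morph c0 : v w / v + w}, forall a, c0 (iota a) = a,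
    forall a i, c0 (iota a * Y ^+ i.+1) = 0 &
    forall a i, c0 (iota a * X ^+ i.+1) = 0].
Proof.
case=> _ /(_ _ _ _ _ gwa_representation) [phi [phia phiX phiY _]].
pose delta (k : int) : int -> A := fun j => (j == k)%:R.
have phiYn i : phi (Y ^+ i) (delta 0) = delta i.
  elim: i => [|i IH]; first by rewrite expr0 rmorph1.
  rewrite exprS rmorphM phiY /= IH /delta; apply: funext => j.
  rewrite (_ : (j - 1 == i%:Z) = (j == i.+1%:Z)); last by lia.
  case: eqP => [-> |_]; last by rewrite rmorph0 mul0r.
  by rewrite rmorph1 mul1r.
have phiXn i : phi (X ^+ i) (delta 0) = delta (- i%:Z).
  elim: i => [|i IH]; first by rewrite expr0 rmorph1.
  rewrite exprS rmorphM phiX /= IH /delta; apply: funext => j.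
  rewrite (_ : (j + 1 == - i%:Z) = (j == - i.+1%:Z)); last by lia.
  case: eqP => [-> |_]; last by rewrite rmorph0 mul0r.
  by rewrite rmorph1 mul1r.
exists (fun w => phi w (delta 0) 0); split=> [v w|a|a i|a i].
- by rewrite rmorphD.
- by rewrite phia /= mulr1.
- by rewrite rmorphM phia /= phiYn /delta mulr0.
- by rewrite rmorphM phia /= phiXn /delta mulr0.
Qed.

End Representation.

End Relations.

(** * Generalities on two-sided ideals *)

Lemma ideal_sum (R : pzRingType) (K : set R) (I : Type) (r : seq I)
    (Q : pred I) (F : I -> R) :
  ideal K -> (forall i, Q i -> K (F i)) -> K (\sum_(i <- r | Q i) F i).
Proof. by case=> K0 KD _ _ KF; apply: big_ind. Qed.

Lemma idealB (R : pzRingType) (K : set R) x y :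
  ideal K -> K x -> K y -> K (x - y).
Proof. by case=> _ KD KMl _ Kx Ky; rewrite -mulN1r; apply/KD/KMl. Qed.

Lemma ideal1 (R : pzRingType) (K : set R) : ideal K -> K 1 -> K = setT.
Proof.
by case=> _ _ KMl _ K1; apply/seteqP; split=> // x _; rewrite -[x]mulr1; apply: KMl.
Qed.

Lemma ideal_setT (R : pzRingType) : ideal [set: R].
Proof. by []. Qed.

(** If [I] is not inside [P], then P + I contains 1 = x + z, and y = x y + z y lies in [P] for every
    y in [K]. *)
Lemma maximal_prime (R : pzRingType) (P : set R) :
  maximal_ideal P -> prime_ideal P.
Proof.
case=> idP PT maxP; split=> // I K idI idK IKP.
have [P0 PD PMl PMr] := idP; have [K0 KD KMl KMr] := idK.
have [I0 ID IMl IMr] := idI.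
pose PI : set R := [set z | exists x y, [/\ P x, I y & z = x + y]].
pose PK : set R := [set z | exists x y, [/\ P x, K y & z = x + y]].
have idPI : ideal PI.
  split=> [|z z' [x [y [Px Iy ->]]] [x' [y' [Px' Iy' ->]]]
           |r z [x [y [Px Iy ->]]]|r z [x [y [Px Iy ->]]]].
  - by exists 0, 0; rewrite addr0.
  - by exists (x + x'), (y + y'); rewrite addrACA; split; auto.
  - by exists (r * x), (r * y); rewrite mulrDr; split; auto.
  - by exists (x * r), (y * r); rewrite mulrDl; split; auto.
have sPPI : P `<=` PI by move=> x Px; exists x, 0; rewrite addr0.
case: (maxP _ idPI sPPI) => [PIP|PIT].
  by left=> y Iy; rewrite -PIP; exists 0, y; rewrite add0r.
right=> y Ky; have : PI 1 by rewrite PIT.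
case=> x [z [Px Iz e1]]; rewrite -[y]mul1r e1 mulrDl.
by apply: PD; [apply: PMr|apply: IKP].
Qed.

(** * The ideal J(M) *)

Section Monomials.
Variables (A : pzRingType) (alpha alphaV : {rmorphism A -> A}).
Hypotheses (alphaK : cancel alpha alphaV) (alphaVK : cancel alphaV alpha).
Variables (u : A) (u_central : central u).
Variables (W : pzRingType) (iota : {rmorphism A -> W}) (X Y : W).
Hypothesis rel : gwa_relations alpha alphaV u iota X Y.

Lemma Yn_iota i a : Y ^+ i * iota a = iota (iter i alpha a) * Y ^+ i.
Proof.
have [_ _ Ya _] := rel; elim: i a => [|i IH] a; first by rewrite mul1r mulr1.
by rewrite exprSr -mulrA Ya mulrA IH -iterSr -mulrA -exprSr.
Qed.

Lemma Xn_iota i a : X ^+ i * iota a = iota (iter i alphaV a) * X ^+ i.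
Proof.
have [_ _ _ Xa] := rel; elim: i a => [|i IH] a; first by rewrite mul1r mulr1.
by rewrite exprSr -mulrA Xa mulrA IH -iterSr -mulrA -exprSr.
Qed.

(** With the next identity, this turns multiples of alpha^(i+1)(u) and of u in degree i into
    products involving degree i + 1, which drives every descent. *)
Lemma iota_alphauYn i a : iota (a * iter i.+1 alpha u) * Y ^+ i =
  iota a * Y ^+ i.+1 * X.
Proof.
have [YX _ _ _] := rel.
by rewrite exprSr -!mulrA YX rmorphM -mulrA iterSr Yn_iota.
Qed.

Lemma iota_uYn i a : iota (a * u) * Y ^+ i = X * (iota (alpha a) * Y ^+ i.+1).
Proof.
have [_ XY _ Xa] := rel.
by rewrite exprS !mulrA Xa alphaK rmorphM -XY mulrA.
Qed.

(** This is the price of moving a negative degree to a nonnegative one by multiplication with a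
    power of [Y]. *)
Lemma XYn i : X ^+ i * Y ^+ i = iota (\prod_(j < i) iter j alphaV u).
Proof.
have [_ XY _ _] := rel.
elim: i => [|i IH]; first by rewrite big_ord0 mulr1 rmorph1.
rewrite exprSr exprS -mulrA [X * _]mulrA XY mulrA Xn_iota -mulrA IH -rmorphM.
rewrite big_ord_recr /=; congr (iota _).
by rewrite (central_iter i alphaK u_central).
Qed.

End Monomials.

Section JIdeal.
Variables (A : pzRingType) (alpha alphaV : {rmorphism A -> A}).
Hypotheses (alphaK : cancel alpha alphaV) (alphaVK : cancel alphaV alpha).
Variables (u : A) (u_central : central u).
Variables (W : pzRingType) (iota : {rmorphism A -> W}) (X Y : W).
Hypothesis W_gwa : is_gwa alpha alphaV u iota X Y.

Let rel : gwa_relations alpha alphaV u iota X Y := W_gwa.1.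

Lemma iter_imageE (M : set A) l a :
  (iter l alphaV @` M) a <-> M (iter l alpha a).
Proof.
split=> [[b Mb <-]|Ma]; first by rewrite iter_can.
by exists (iter l alpha a); rewrite ?iter_can.
Qed.

(** Images under alpha^(-l) become preimages under alpha^l, and the case i >= m is absorbed since
    the condition is then void. *)
Lemma J_coefYE m (M : set A) i a :
  J_coefY alphaV m M i a <-> forall l, (l + i < m)%N -> M (iter l alpha a).
Proof.
rewrite /J_coefY; case: leqP => im; first by split=> // _ l; lia.
by split=> aP l lm; apply/iter_imageE/aP => /=; move: lm => /=; lia.
Qed.

Lemma J_coefXE m (M : set A) i b :
  J_coefX alphaV m M i b <->
  forall l, (i <= l)%N -> (l < m)%N -> M (iter l alpha b).
Proof.
rewrite /J_coefX; case: leqP => im; first by split=> // _ l; lia.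
split=> [bP l il lm|bP l /= lm]; apply/iter_imageE/bP => /=; lia.
Qed.

(** * J(M) is an ideal whenever M is an ideal containing u and alpha^m(u) *)

Section Closure.
Variables (m : nat) (M : set A).
Hypotheses (idM : ideal M) (Mu : M u) (Mum : M (iter m alpha u)).

Let J := J_ideal alphaV iota X Y m M.
Let IY := J_coefY alphaV m M.
Let IX := J_coefX alphaV m M.

Lemma J_coefY_ideal i : ideal (IY i).
Proof.
have [M0 MD MMl MMr] := idM.
split=> [|a b /J_coefYE aP /J_coefYE bP|r a /J_coefYE aP|r a /J_coefYE aP];
  apply/J_coefYE => l lm; rewrite ?iter_rmorph0 ?iter_rmorphD ?iter_rmorphM //.
- by apply: MD; auto.
- by apply: MMl; auto.
- by apply: MMr; auto.
Qed.

Lemma J_coefX_ideal i : ideal (IX i).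
Proof.
have [M0 MD MMl MMr] := idM.
split=> [|a b /J_coefXE aP /J_coefXE bP|r a /J_coefXE aP|r a /J_coefXE aP];
  apply/J_coefXE => l il lm; rewrite ?iter_rmorph0 ?iter_rmorphD ?iter_rmorphM //.
- by apply: MD; auto.
- by apply: MMl; auto.
- by apply: MMr; auto.
Qed.

Lemma J_coefX0 : IX 0 = IY 0.
Proof.
apply/seteqP; split=> a.
  by move=> /J_coefXE aP; apply/J_coefYE => l; rewrite addn0; apply: aP.
move=> /J_coefYE aP; apply/J_coefXE => l _.
by rewrite -[X in (X < _)%N]addn0; apply: aP.
Qed.

Lemma J_ideal_ind (P : set W) :
  P 0 -> (forall v w, P v -> P w -> P (v + w)) ->
  (forall i a, IY i a -> P (iota a * Y ^+ i)) ->
  (forall i a, IX i a -> P (iota a * X ^+ i)) -> J `<=` P.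
Proof.
move=> P0 PD PY PX w [n [a [b [aP bP ->]]]].
apply: (PD); apply: (big_ind P P0 PD) => i _; first exact/PY/aP.
exact/PX/bP.
Qed.

Lemma JY i a : IY i a -> J (iota a * Y ^+ i).
Proof.
move=> aP; exists i.+1, (fun j => if j == i then a else 0), (fun=> 0); split.
- by move=> j; case: (eqVneq j i) => [->//|_]; case: (J_coefY_ideal j).
- by move=> j; case: (J_coefX_ideal j).
- rewrite big_nat_recr //= eqxx big_nat big1 => [|j /andP[_ ji]].
    by rewrite add0r big1 ?addr0 // => j _; rewrite rmorph0 mul0r.
  by rewrite ltn_eqF // rmorph0 mul0r.
Qed.

Lemma JX i a : IX i a -> J (iota a * X ^+ i).
Proof.
case: i => [|i] aP.
  by rewrite expr0 -(expr0 Y); apply: JY; rewrite -J_coefX0.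
exists i.+2, (fun=> 0), (fun j => if j == i.+1 then a else 0); split.
- by move=> j; case: (J_coefY_ideal j).
- by move=> j; case: (eqVneq j i.+1) => [->//|_]; case: (J_coefX_ideal j).
- rewrite big1 ?add0r => [|j _]; last by rewrite rmorph0 mul0r.
  rewrite big_nat_recr //= eqxx big_nat big1 ?add0r // => j /andP[_ ji].
  by rewrite ltn_eqF // rmorph0 mul0r.
Qed.

Lemma J0 : J 0.
Proof.
rewrite -(mul0r (Y ^+ 0)) -(rmorph0 iota); apply: JY.
by case: (J_coefY_ideal 0).
Qed.

Lemma JD v w : J v -> J w -> J (v + w).
Proof.
case=> n [a [b [aP bP ->]]] [n' [a' [b' [aP' bP' ->]]]].
(* Both presentations are cut off at their own length, since their coefficients are arbitrary beyond
   it, and padded with zeros to a common length. *)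
exists (n + n')%N, (fun i => (if (i < n)%N then a i else 0) +
                             (if (i < n')%N then a' i else 0)),
  (fun i => (if (i < n)%N then b i else 0) + (if (i < n')%N then b' i else 0)).
split=> [i|i|].
- have [IY0 IYD _ _] := J_coefY_ideal i.
  by apply: IYD; case: ifP => _; solve [exact: IY0|exact: aP|exact: aP'].
- have [IX0 IXD _ _] := J_coefX_ideal i.
  by apply: IXD; case: ifP => _; solve [exact: IX0|exact: bP|exact: bP'].
have ext k p q (c : nat -> A) Z : (p <= q)%N ->
    \sum_(k <= i < p) iota (c i) * Z ^+ i =
    \sum_(k <= i < q) iota (if (i < p)%N then c i else 0) * Z ^+ i.
  move=> pq; rewrite (big_nat_widen _ _ _ _ _ pq) big_mkcond /=.
  by apply: eq_bigr => i _; case: ifP => // _; rewrite rmorph0 mul0r.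
do 2![rewrite (ext _ n (n + n')%N) ?leq_addr // (ext _ n' (n + n')%N) ?leq_addl //].
rewrite addrACA -!big_split /=.
by congr (_ + _); apply: eq_bigr => i _; rewrite rmorphD mulrDl.
Qed.

Lemma J_opp w : J w -> J (- w).
Proof.
move: w; apply: J_ideal_ind => [|v w Jv Jw|i a aP|i a aP].
- by rewrite oppr0; apply: J0.
- by rewrite opprD; apply: JD.
- rewrite -mulNr -rmorphN -mulN1r; apply: JY.
  by have [_ _ IYl _] := J_coefY_ideal i; apply: IYl.
- rewrite -mulNr -rmorphN -mulN1r; apply: JX.
  by have [_ _ IXl _] := J_coefX_ideal i; apply: IXl.
Qed.

(** The multipliers that preserve [J] form a subring, so [iota a], [X] and [Y] suffice. When the
    degree moves towards 0, the coefficient condition gains one index; there the new factor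
    contributes [u] or alpha^m(u), both in [M]. *)
Lemma J_mull r w : J w -> J (r * w).
Proof.
have [YX XY Ya Xa] := rel; have [M0 MD MMl MMr] := idM.
move: r w; apply: (gwa_generated W_gwa) => [w|v z vJ zJ w Jw|v z vJ zJ w Jw|r||].
- by rewrite mul1r.
- by rewrite mulrBl; apply: JD; [apply: vJ|apply/J_opp/zJ].
- by rewrite -mulrA; apply/vJ/zJ.
- apply: J_ideal_ind => [|v w Jv Jw|i a aP|i a aP].
  + by rewrite mulr0; apply: J0.
  + by rewrite mulrDr; apply: JD.
  + rewrite mulrA -rmorphM; apply: JY.
    by have [_ _ IYl _] := J_coefY_ideal i; apply: IYl.
  + rewrite mulrA -rmorphM; apply: JX.
    by have [_ _ IXl _] := J_coefX_ideal i; apply: IXl.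
- apply: J_ideal_ind => [|v w Jv Jw|[|i] a /J_coefYE aP|i a /J_coefXE aP].
  + by rewrite mulr0; apply: J0.
  + by rewrite mulrDr; apply: JD.
  + rewrite expr0 mulr1 Xa -[X]expr1; apply: JX.
    apply/J_coefXE => -[//|l] _ lm; rewrite iterSr alphaVK.
    by apply: aP; rewrite addn0; apply: ltnW.
  + rewrite -{1}[a]alphaVK -(iota_uYn alphaK rel); apply: JY.
    apply/J_coefYE => -[|l] lm.
      exact: MMl.
    rewrite iter_rmorphM; apply: MMr; rewrite iterSr alphaVK; apply: aP.
    by rewrite addnS -addSn.
  + rewrite mulrA Xa -mulrA -exprS; apply: JX; apply/J_coefXE => -[//|l] il lm.
    by rewrite iterSr alphaVK; apply: aP => //; apply: ltnW.
- apply: J_ideal_ind => [|v w Jv Jw|i a /J_coefYE aP|[|i] a /J_coefXE aP].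
  + by rewrite mulr0; apply: J0.
  + by rewrite mulrDr; apply: JD.
  + rewrite mulrA Ya -mulrA -exprS; apply: JY; apply/J_coefYE => l lm.
    by rewrite -iterSr; apply: aP; rewrite addSnnS.
  + rewrite expr0 mulr1 Ya -[Y]expr1; apply: JY; apply/J_coefYE => l lm.
    by rewrite -iterSr; apply: aP => //; rewrite addn1 in lm.
  + rewrite exprS !mulrA Ya -[_ * Y * X]mulrA YX -rmorphM; apply: JX.
    apply/J_coefXE => l il lm; rewrite iter_rmorphM -!iterSr.
    have := lm; rewrite leq_eqVlt => /predU1P[-> |lm']; first exact: MMl.
    by apply: MMr; apply: aP.
Qed.

Lemma J_mulr r w : J w -> J (w * r).
Proof.
have [YX XY Ya Xa] := rel; have [M0 MD MMl MMr] := idM.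
move: r w; apply: (gwa_generated W_gwa) => [w|v z vJ zJ w Jw|v z vJ zJ w Jw|r||].
- by rewrite mulr1.
- by rewrite mulrBr; apply: JD; [apply: vJ|apply/J_opp/zJ].
- by rewrite mulrA; apply/zJ/vJ.
- apply: J_ideal_ind => [|v w Jv Jw|i a aP|i a aP].
  + by rewrite mul0r; apply: J0.
  + by rewrite mulrDl; apply: JD.
  + rewrite -mulrA (Yn_iota rel) mulrA -rmorphM; apply: JY.
    by have [_ _ _ IYr] := J_coefY_ideal i; apply: IYr.
  + rewrite -mulrA (Xn_iota rel) mulrA -rmorphM; apply: JX.
    by have [_ _ _ IXr] := J_coefX_ideal i; apply: IXr.
- apply: J_ideal_ind => [|v w Jv Jw|[|i] a /J_coefYE aP|i a /J_coefXE aP].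
  + by rewrite mul0r; apply: J0.
  + by rewrite mulrDl; apply: JD.
  + rewrite mulr1 -[X]expr1; apply: JX; apply/J_coefXE => l _ lm.
    by apply: aP; rewrite addn0.
  + rewrite -(iota_alphauYn rel); apply: JY; apply/J_coefYE => l lm.
    rewrite iter_rmorphM -iterD.
    have := lm; rewrite leq_eqVlt -addnS => /predU1P[-> |lm']; first exact: MMl.
    by apply: MMr; apply: aP.
  + rewrite -mulrA -exprSr; apply: JX; apply/J_coefXE => l il lm.
    by apply: aP => //; apply: ltnW.
- apply: J_ideal_ind => [|v w Jv Jw|i a /J_coefYE aP|[|i] a /J_coefXE aP].
  + by rewrite mul0r; apply: J0.
  + by rewrite mulrDl; apply: JD.
  + rewrite -mulrA -exprSr; apply: JY; apply/J_coefYE => l lm.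
    by apply: aP; rewrite addnS in lm; apply: ltnW.
  + rewrite mulr1 -[Y]expr1; apply: JY; apply/J_coefYE => l lm.
    by apply: aP => //; rewrite addn1 in lm; apply: ltnW.
  + rewrite exprSr -!mulrA XY (Xn_iota rel) mulrA -rmorphM; apply: JX.
    apply/J_coefXE => l il lm; rewrite iter_rmorphM.
    have := il; rewrite leq_eqVlt => /predU1P[<- |il'].
      by apply: MMl; rewrite iter_can.
    by apply: MMr; apply: aP.
Qed.

Lemma J_is_ideal : ideal J.
Proof. by split; [apply: J0|apply: JD|apply: J_mull|apply: J_mulr]. Qed.
End Closure.

(** For m = 0 and M = A, the set J(M) consists of all such sums; being an ideal that contains 1, it
    is the whole of [W]. *)
Lemma gwa_span w : exists n a b,
  w = \sum_(0 <= i < n) iota (a i) * Y ^+ i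
    + \sum_(1 <= i < n) iota (b i) * X ^+ i.
Proof.
have idJ := @J_is_ideal 0 setT (ideal_setT A) I I.
have: J_ideal alphaV iota X Y 0 setT w.
  rewrite (ideal1 idJ) //; rewrite -(expr0 Y) -[_ ^+ _]mul1r -(rmorph1 iota).
  exact: JY.
by case=> n [a [b [_ _ ->]]]; exists n, a, b.
Qed.

End JIdeal.

(** * Powers in ideals, and the ideal spanned by two central elements *)

Lemma ideal_exp (R : pzRingType) (K : set R) x i j :
  ideal K -> (i <= j)%N -> K (x ^+ i) -> K (x ^+ j).
Proof. by case=> _ _ KMl _ ij Kx; rewrite -(subnK ij) exprD; apply: KMl. Qed.

Lemma lspan2_setT (R : pzRingType) (x y : R) :
  (exists a b, 1 = a * x + b * y) -> lspan2 x y = setT.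
Proof.
move=> [a [b e1]]; apply/seteqP; split=> // c _.
by exists (c * a), (c * b); rewrite -!mulrA -mulrDr -e1 mulr1.
Qed.

Lemma lspan2_ideal (R : pzRingType) (x y : R) :
  central x -> central y -> ideal (lspan2 x y).
Proof.
move=> cx cy; split.
- by exists 0, 0; rewrite !mul0r addr0.
- move=> _ _ [a [b ->]] [c [d ->]]; exists (a + c), (b + d).
  by rewrite !mulrDl addrACA.
- by move=> r _ [a [b ->]]; exists (r * a), (r * b); rewrite mulrDr !mulrA.
- move=> r _ [a [b ->]]; exists (a * r), (b * r).
  by rewrite mulrDl -!mulrA cx cy.
Qed.

(** * Maximality of J(M) *)

Section Descent.
Variables (A : pzRingType) (alpha alphaV : {rmorphism A -> A}).
Hypotheses (alphaK : cancel alpha alphaV) (alphaVK : cancel alphaV alpha).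
Variables (u : A) (W : pzRingType) (iota : {rmorphism A -> W}) (X Y : W).
Hypothesis rel : gwa_relations alpha alphaV u iota X Y.

Lemma iter_alphaV_shift i (v : A) : iter i.+1 alphaV (alpha v) = iter i alphaV v.
Proof. by rewrite iterSr alphaK. Qed.

(** Apply alpha^(-i) to 1 = a u + b alpha^(i+1)(u). The result is comaximality for the algebra with
    [X] and [Y] exchanged. *)
Lemma comaximal_sym i : lspan2 u (iter i.+1 alpha u) = setT ->
  lspan2 (alpha u) (iter i.+1 alphaV (alpha u)) = setT.
Proof.
move=> comax; have : lspan2 u (iter i.+1 alpha u) 1 by rewrite comax.
case=> a [b /(congr1 (iter i alphaV))].
rewrite iter_rmorph1 iter_rmorphD !iter_rmorphM [iter i.+1 _ _]iterSr.
rewrite (iter_can _ alphaK) => e1; apply: lspan2_setT.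
by exists (iter i alphaV b), (iter i alphaV a); rewrite iter_alphaV_shift addrC.
Qed.

(** From 1 = a u + b alpha^(i+1)(u) follows Y^i = X alpha(a) Y^(i+1) + b Y^(i+1) X. *)
Lemma ideal_pred_expY (K : set W) i : ideal K ->
  lspan2 u (iter i.+1 alpha u) = setT -> K (Y ^+ i.+1) -> K (Y ^+ i).
Proof.
move=> [_ KD KMl KMr] comax KY.
have : lspan2 u (iter i.+1 alpha u) 1 by rewrite comax.
case=> a [b e1]; rewrite -[Y ^+ i]mul1r -(rmorph1 iota) e1 rmorphD mulrDl.
rewrite (iota_uYn alphaK rel) (iota_alphauYn rel).
by apply: KD; [apply/KMl/KMl|apply/KMr/KMl].
Qed.

Variables (u_central : central u) (m : nat).
Hypothesis comaximal : forall i : nat, (0 < i)%N -> i <> m ->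
  lspan2 u (iter i alpha u) = setT.

Lemma ideal_expY_m (K : set W) r : ideal K -> K (Y ^+ r) -> K (Y ^+ m).
Proof.
move=> idK; elim: r => [|r IH] Kr; first exact: ideal_exp Kr.
have [rm|mr] := leqP r.+1 m; first exact: ideal_exp Kr.
apply: IH; apply: (ideal_pred_expY idK _ Kr).
by apply: comaximal; lia.
Qed.

(** Downward induction on the degree, with a = x u + y alpha^(i+1)(u). Below degree m - 1 this comes
    from multiplying an expression of 1 by [a]; in degree m - 1 it is the membership of [a] in
    [M]. *)
Lemma J_Ypart_sub (K : set W) i a : (0 < m)%N -> ideal K -> K (Y ^+ m) ->
  J_coefY alphaV m (lspan2 u (iter m alpha u)) i a -> K (iota a * Y ^+ i).
Proof.
move=> m_gt0 idK KY; have [K0 KD KMl KMr] := idK.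
set M := lspan2 _ _.
have [k] := ubnP (m - i); elim: k i a => // k IH i a ik aP.
have [mi|im] := leqP m i; first by apply: KMl; apply: ideal_exp KY.
move/(J_coefYE alphaK alphaVK): aP => aP.
suff [x [y [-> xP yP]]] : exists x y, [/\ a = x * u + y * iter i.+1 alpha u,
    J_coefY alphaV m M i.+1 (alpha x) & J_coefY alphaV m M i.+1 y].
  rewrite rmorphD mulrDl (iota_uYn alphaK rel) (iota_alphauYn rel).
  by apply: KD; [apply/KMl/IH|apply/KMr/IH] => //; lia.
have [im1|im1] := eqVneq i.+1 m.
  have [x [y e]] := aP 0 im; exists x, y; rewrite im1; split=> //.
    by rewrite /J_coefY leqnn.
  by rewrite /J_coefY leqnn.
have := comaximal (ltn0Sn i) (elimN eqP im1) => comax.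
have : lspan2 u (iter i.+1 alpha u) 1 by rewrite comax.
have [_ _ _ MMr] : ideal M.
  by apply: lspan2_ideal => //; apply: central_iter alphaVK _.
case=> x [y e1]; exists (a * x), (a * y); rewrite -!mulrA -mulrDr -e1 mulr1.
split=> //; apply/(J_coefYE alphaK alphaVK) => l lm.
  by rewrite -iterSr iter_rmorphM; apply/MMr/aP; rewrite addSnnS.
by rewrite iter_rmorphM; apply/MMr/aP; apply: ltnW; rewrite -addnS.
Qed.

End Descent.

Section Maximality.
Variables (A : pzRingType) (alpha alphaV : {rmorphism A -> A}).
Hypotheses (alphaK : cancel alpha alphaV) (alphaVK : cancel alphaV alpha).
Variables (u : A) (u_central : central u).
Variables (W : pzRingType) (iota : {rmorphism A -> W}) (X Y : W).
Hypothesis W_gwa : is_gwa alpha alphaV u iota X Y.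
Variables (m : nat) (m_gt0 : (0 < m)%N).
Hypothesis comaximal : forall i : nat, (0 < i)%N -> i <> m ->
  lspan2 u (iter i alpha u) = setT.

Let rel : gwa_relations alpha alphaV u iota X Y := W_gwa.1.
Let M := lspan2 u (iter m alpha u).
Let J := J_ideal alphaV iota X Y m M.

Let iter_central i : central (iter i alpha u).
Proof. exact: central_iter alphaVK u_central. Qed.

Let idM : ideal M. Proof. exact: lspan2_ideal. Qed.

Let Mu : M u. Proof. by exists 1, 0; rewrite mul1r mul0r addr0. Qed.

Let Mum : M (iter m alpha u).
Proof. by exists 0, 1; rewrite mul1r mul0r add0r. Qed.

Let idJ : ideal J. Proof. exact: (J_is_ideal alphaK alphaVK W_gwa idM Mu Mum). Qed.

Lemma J_sub (K : set W) r s :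
  ideal K -> K (X ^+ r) -> K (Y ^+ s) -> J `<=` K.
Proof.
move=> idK KX KY; have [K0 KD _ _] := idK.
have comaximalV i : (0 < i)%N -> i <> m ->
    lspan2 (alpha u) (iter i alphaV (alpha u)) = setT.
  by case: i => // i _ im; apply/(comaximal_sym alphaK)/comaximal.
have relV := (gwa_relations_sym alphaK u iota X Y).2 rel.
have {}KY := ideal_expY_m alphaK rel comaximal idK KY.
have {}KX := ideal_expY_m alphaVK relV comaximalV idK KX.
apply: J_ideal_ind => // i a aP.
  exact: (J_Ypart_sub alphaK alphaVK rel u_central comaximal m_gt0 idK KY).
have au_central := central_can alphaVK u_central.
apply: (J_Ypart_sub alphaVK alphaK relV au_central comaximalV m_gt0 idK KX).
(* After the exchange the role of [M] is played by alpha^(1-m)(M). So alpha^(-l)(a) lies in it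
   exactly when alpha^(m-1-l)(a) lies in [M], whence the index [m.-1 - l]. *)
apply/(J_coefYE alphaVK alphaK) => l lm.
have := (J_coefXE alphaK alphaVK m M i a).1 aP (m.-1 - l)%N.
have [k mE] : exists k, m = (k + l).+1 by exists (m.-1 - l)%N; lia.
rewrite mE /= addnK in aP lm * => /(_ _ _)[||x [y /(congr1 (iter (k + l) alphaV))]].
- by lia.
- by lia.
rewrite iter_rmorphD !iter_rmorphM mE [iter _.+1 alpha u]iterSr (iter_can _ alphaK).
have -> : iter (k + l) alphaV (iter k alpha a) = iter l alphaV a.
  by rewrite addnC iterD (iter_can _ alphaK).
move=> ->.
exists (iter (k + l) alphaV y), (iter (k + l) alphaV x).
by rewrite -iterS iterSr alphaK addrC.
Qed.

(** As [M] contains [u], comaximality makes alpha^s(u) invertible modulo [M]. *)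
Lemma M_mul_iter_alpha s x :
  (0 < s)%N -> s <> m -> M (x * iter s alpha u) -> M x.
Proof.
have [_ MD MMl MMr] := idM.
move=> s_gt0 sm Mx; have : lspan2 u (iter s alpha u) 1 by rewrite comaximal.
case=> p [q e1]; rewrite -[x]mulr1 e1 mulrDr; apply: MD.
  exact/MMl/MMl.
by rewrite iter_central mulrA; apply: MMr.
Qed.

(** The factors become alpha^(l-j)(u) with j < N; the bounds on [l] give 0 < l - j < m, so each can
    be cancelled modulo [M]. *)
Lemma M_mul_iter_prod N l x : (N <= l < m)%N ->
  M (x * iter l alpha (\prod_(j < N) iter j alphaV u)) -> M x.
Proof.
elim: N x => [|N IH] x Nl; first by rewrite big_ord0 iter_rmorph1 mulr1.
rewrite big_ord_recr /= iter_rmorphM mulrA => Mx.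
apply: IH; first by lia.
apply: (@M_mul_iter_alpha (l - N)); [lia|lia|].
have -> : iter (l - N) alpha u = iter l alpha (iter N alphaV u) => //.
by rewrite -[in RHS](subnK (_ : (N <= l)%N)) ?iterD ?(iter_can _ alphaVK) //; lia.
Qed.

(** * Proper ideals containing J(M) *)

Section Proper.
Hypothesis M_maximal : maximal_ideal M.
Variables (K : set W) (idK : ideal K) (K1 : ~ K 1) (sJK : J `<=` K).

Let KYm i : (m <= i)%N -> K (Y ^+ i).
Proof.
move=> mi; apply: ideal_exp mi _ => //; apply: sJK.
rewrite -[_ ^+ _]mul1r -(rmorph1 iota); apply: JY => //.
by rewrite /J_coefY leqnn.
Qed.

(** The coefficients of Y^(m-1) in [K] form an ideal containing [M]. Were it all of [A], the descent
    from Y^(m-1) would put 1 in [K]. *)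
Lemma coef_top c : K (iota c * Y ^+ m.-1) -> M c.
Proof.
move=> Kc; have [K0 KD KMl KMr] := idK; have [_ _ maxM] := M_maximal.
pose L : set A := [set c | K (iota c * Y ^+ m.-1)].
have idL : ideal L.
  split=> [|a b La Lb|r a La|r a La]; rewrite /L /= ?rmorph0 ?mul0r //.
  - by rewrite rmorphD mulrDl; apply: KD.
  - by rewrite rmorphM -mulrA; apply: KMl.
  - rewrite -[r](iter_can m.-1 alphaVK) rmorphM -mulrA -(Yn_iota rel) mulrA.
    exact: KMr.
have sML : M `<=` L.
  move=> a Ma; apply: sJK; apply: JY => //.
  by apply/(J_coefYE alphaK alphaVK) => -[//|l]; lia.
have [<- //|LT] := maxM L idL sML.
have /(_ _ (leqnn _)) : forall i, (i <= m.-1)%N -> K (Y ^+ (m.-1 - i)).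
  elim=> [_|i IH im].
    have : L 1 by rewrite LT.
    by rewrite /L /= rmorph1 mul1r subn0.
  apply: (ideal_pred_expY alphaK rel) => //.
    by apply: comaximal; lia.
  by rewrite -subSn //; apply: IH; apply: ltnW.
by rewrite subnn.
Qed.

Lemma coefY_proper n s a : K (\sum_(0 <= i < n) iota (a i) * Y ^+ (s + i)) ->
  forall i, (i < n)%N -> J_coefY alphaV m M (s + i) (a i).
Proof.
have [K0 KD KMl KMr] := idK.
elim: n s a => // n IH s a; rewrite big_nat_recl // addn0 => Kw.
have IYs : J_coefY alphaV m M s (a 0%N).
  apply/(J_coefYE alphaK alphaVK) => l lm; apply: coef_top.
  (* Multiplying by Y^l on the left and Y^q on the right makes the lowest term alpha^l(a_0) Y^(m-1);
     all other terms reach degree at least m, hence lie in [K]. *)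
  have [q mE] : exists q, m = (l + s + q).+1 by exists (m.-1 - (l + s))%N; lia.
  have := KMr (Y ^+ q) _ (KMl (Y ^+ l) _ Kw); rewrite mulrDr mulrDl mE /=.
  rewrite !mulrA (Yn_iota rel) -2!mulrA -!exprD addnA.
  set z := (X in K (_ + X)) => Kz.
  suff : K z by move=> /(idealB idK Kz); rewrite addrK.
  rewrite /z mulr_sumr mulr_suml; apply: ideal_sum => // i _.
  rewrite !mulrA (Yn_iota rel) -2!mulrA -!exprD; apply/KMl/KYm; lia.
case=> [_|i lt_in]; first by rewrite addn0.
rewrite -addSnnS; apply: (IH s.+1 (fun i => a i.+1)) => //.
have := idealB idK Kw (sJK (JY alphaK alphaVK iota X Y idM IYs)).
rewrite addrAC subrr add0r.
by under eq_bigr do rewrite -addSnnS.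
Qed.

Lemma coefX_proper N n a b :
  K (\sum_(0 <= i < n) iota (a i) * Y ^+ i
     + \sum_(1 <= i < N) iota (b i) * X ^+ i) ->
  forall i, (0 < i < N)%N -> J_coefX alphaV m M i (b i).
Proof.
have [K0 KD KMl KMr] := idK.
have shift l q i c : (i <= q)%N -> Y ^+ l * (iota c * X ^+ i) * Y ^+ q =
    iota (iter l alpha (c * \prod_(j < i) iter j alphaV u)) * Y ^+ (l + q - i).
  move=> iq; rewrite -addnBA // -[in LHS](subnKC iq) !exprD.
  by rewrite [RHS]mulrA -(Yn_iota rel) rmorphM -(XYn alphaK u_central rel) !mulrA.
elim: N => [|N IH]; first by move=> _ i; rewrite ltn0 andbF.
have [->|N_gt0] := posnP N; first by move=> _ i; lia.
rewrite big_nat_recr //= addrA => Kw.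
have IXN : J_coefX alphaV m M N (b N).
  apply/(J_coefXE alphaK alphaVK) => l Nl lm.
  apply: (@M_mul_iter_prod N l); first by rewrite Nl.
  rewrite -iter_rmorphM; apply: coef_top.
  (* The exponents sum to m - 1 + N, so the term in X^N lands in degree m - 1 and all others in
     degree at least m. As l < m, the right factor is long enough to absorb X^N. *)
  have := KMr (Y ^+ (m.-1 + N - l)) _ (KMl (Y ^+ l) _ Kw).
  rewrite mulrDr mulrDl shift; last by lia.
  rewrite (_ : (l + (m.-1 + N - l) - N)%N = m.-1); last by lia.
  set z := (X in K (X + _)) => Kz.
  suff : K z by move=> /(idealB idK Kz); rewrite addrAC subrr add0r.
  rewrite /z mulrDr mulrDl !mulr_sumr !mulr_suml big_nat [in X in _ + X]big_nat.
  apply: KD; apply: ideal_sum => // i iN.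
    by rewrite !mulrA (Yn_iota rel) -2!mulrA -!exprD; apply/KMl/KYm; lia.
  by rewrite shift; [apply/KMl/KYm|]; lia.
move=> i /andP[i_gt0]; rewrite ltnS leq_eqVlt => /predU1P[->//|iN].
apply: IH; last by rewrite i_gt0.
by have := idealB idK Kw (sJK (JX alphaK alphaVK iota X Y idM IXN)); rewrite addrK.
Qed.

Lemma proper_sub_J : K `<=` J.
Proof.
move=> w; have [n [a [b ->]]] := gwa_span alphaK alphaVK W_gwa w => Kw.
have [J0 JD _ _] := idJ; have IX := coefX_proper Kw.
have Jb : J (\sum_(1 <= i < n) iota (b i) * X ^+ i).
  by rewrite big_nat; apply: ideal_sum => // i /IX; apply: JX.
apply: (JD _ _ _ Jb); have := idealB idK Kw (sJK Jb); rewrite addrK => Ka.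
rewrite big_nat; apply: ideal_sum => // i /andP[_ /(@coefY_proper n 0 a Ka)].
exact: JY.
Qed.

End Proper.

Lemma J_maximal : maximal_ideal M -> maximal_ideal J.
Proof.
move=> M_maximal; split=> // [JT|K idK sJK].
  (* Properness: the degree zero part of an expression of 1 in [J] gives 1 = a_0, or 1 = 0 if the
     sum is empty; either way 1 lies in [M]. *)
  have [c0 [c0D c0a c0Y c0X]] := gwa_degree0 alphaK alphaVK u_central W_gwa.
  have c00 : c0 0 = 0 by rewrite -(rmorph0 iota) c0a.
  have : J 1 by rewrite JT.
  case=> n [a [b [aP _ /(congr1 c0)]]].
  rewrite -(rmorph1 iota) c0a c0D !(big_morph c0 c0D c00).
  rewrite [X in _ + X]big_nat [X in _ + X]big1 => [|[//|i] _]; last exact: c0X.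
  suff : M 1 -> False.
    rewrite addr0; case: n => [|n] M1.
      by rewrite big_geq // => e1; apply: M1; rewrite e1; case: idM.
    rewrite big_nat_recl // mulr1 c0a big1 => [|i _]; last exact: c0Y.
    rewrite addr0 => e1; apply: M1; rewrite e1.
    exact: ((J_coefYE alphaK alphaVK m M 0 (a 0%N)).1 (aP 0%N) 0%N).
  by case: M_maximal => _ MT _ /(ideal1 idM).
have [K1|K1] := pselect (K 1); first by right; apply: ideal1.
by left; apply/seteqP; split=> //; apply: proper_sub_J.
Qed.

Lemma J_expX : J (X ^+ m).
Proof.
rewrite -[_ ^+ _]mul1r -(rmorph1 iota); apply: JX => //.
by rewrite /J_coefX leqnn.
Qed.

Lemma J_expY : J (Y ^+ m).
Proof.
rewrite -[_ ^+ _]mul1r -(rmorph1 iota); apply: JY => //.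
by rewrite /J_coefY leqnn.
Qed.

End Maximality.

(** * Ideals of W over an alpha-simple ring *)

Section AlphaSimple.
Variables (A : pzRingType) (alpha alphaV : {rmorphism A -> A}).
Hypotheses (alphaK : cancel alpha alphaV) (alphaVK : cancel alphaV alpha).
Variables (u : A) (u_central : central u) (u_regular : regular u).

Lemma regular_prod i : regular (\prod_(j < i) iter j alphaV u).
Proof.
apply: (big_ind (@regular A)) => [|x y [lx rx] [ly ry]|j _].
- by split; [apply: lreg1|apply: rreg1].
- by split; [apply: lregM|apply: rregM].
- by elim: (nat_of_ord j) => //= k; apply: regular_can alphaVK alphaK.
Qed.

Variables (W : pzRingType) (iota : {rmorphism A -> W}) (X Y : W).
Hypothesis W_gwa : is_gwa alpha alphaV u iota X Y.
Variables (K : set W) (idK : ideal K).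

Let rel : gwa_relations alpha alphaV u iota X Y := W_gwa.1.

(* The multiplication by powers of [Y] that aligns two such elements is why the
   lowest degree [p] is left free: it makes [low_coef n] an ideal. *)
Definition low_coef (n : nat) : set A :=
  [set a | exists p c, K (iota a * Y ^+ p
                          + \sum_(0 <= i < n) iota (c i) * Y ^+ (p.+1 + i))].

Lemma low_coef0 n : low_coef n 0.
Proof.
exists 0%N, (fun=> 0); rewrite big1 => [|i _]; last by rewrite rmorph0 mul0r.
by rewrite rmorph0 mul0r addr0; case: idK.
Qed.

Lemma low_coefD n a b : low_coef n a -> low_coef n b -> low_coef n (a + b).
Proof.
have [_ KD _ KMr] := idK.
have shift p q (c : nat -> A) d : (iota d * Y ^+ p
      + \sum_(0 <= i < n) iota (c i) * Y ^+ (p.+1 + i)) * Y ^+ q =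
    iota d * Y ^+ (p + q)
      + \sum_(0 <= i < n) iota (c i) * Y ^+ ((p + q).+1 + i).
  rewrite mulrDl mulr_suml -mulrA -exprD; congr (_ + _).
  by apply: eq_bigr => i _; rewrite -mulrA -exprD -addSn addnAC.
move=> [p [c Ka]] [q [d Kb]]; exists (p + q)%N, (fun i => c i + d i).
have := KD _ _ (KMr (Y ^+ q) _ Ka) (KMr (Y ^+ p) _ Kb).
rewrite !shift [(q + p)%N]addnC addrACA -mulrDl -rmorphD -big_split /=.
by under eq_bigr do rewrite -mulrDl -rmorphD.
Qed.

Lemma low_coefMl n r a : low_coef n a -> low_coef n (r * a).
Proof.
have [_ _ KMl _] := idK.
case=> p [c Ka]; exists p, (fun i => r * c i).
have := KMl (iota r) _ Ka; rewrite mulrDr mulr_sumr mulrA -rmorphM.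
by under eq_bigr do rewrite mulrA -rmorphM.
Qed.

Lemma low_coefMr n r a : low_coef n a -> low_coef n (a * r).
Proof.
have [_ _ _ KMr] := idK.
case=> p [c Ka]; pose r' := iter p alphaV r.
exists p, (fun i => c i * iter (p.+1 + i) alpha r').
have := KMr (iota r') _ Ka; rewrite mulrDl mulr_suml -mulrA (Yn_iota rel) mulrA.
rewrite -rmorphM (iter_can _ alphaVK).
by under eq_bigr do rewrite -mulrA (Yn_iota rel) mulrA -rmorphM.
Qed.

Lemma low_coef_alpha n k a : low_coef n a -> low_coef n (iter k alpha a).
Proof.
have [_ _ KMl _] := idK; have [_ _ Ya _] := rel.
elim: k => //= k IH /IH{IH} [p [c Ka]]; exists p.+1, (fun i => alpha (c i)).
have := KMl Y _ Ka; rewrite mulrDr mulr_sumr mulrA Ya -mulrA -exprS.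
by under eq_bigr do rewrite mulrA Ya -mulrA -exprS -addSn.
Qed.

Lemma low_coef1 n a : alpha_simple alpha -> low_coef n a -> a <> 0 ->
  low_coef n 1.
Proof.
case=> _ simple La a0.
(* [low_coef n] is only known to be mapped into itself by alpha; the union of its preimages under
   all alpha^k is an ideal equal to its image. Since alpha^k(1) = 1, finding 1 in the union
   suffices. *)
pose L : set A := [set b | exists k, low_coef n (iter k alpha b)].
have idL : ideal L.
  split=> [|b c [k Lb] [l Lc]|r b [k Lb]|r b [k Lb]].
  - by exists 0%N; apply: low_coef0.
  - exists (k + l)%N; rewrite iter_rmorphD; apply: low_coefD.
      by rewrite addnC iterD; apply: low_coef_alpha.
    by rewrite iterD; apply: low_coef_alpha.
  - by exists k; rewrite iter_rmorphM; apply: low_coefMl.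
  - by exists k; rewrite iter_rmorphM; apply: low_coefMr.
have alphaL : alpha @` L = L.
  apply/seteqP; split=> [_ [b [k Lb] <-]|b [k Lb]].
    by exists k; rewrite -iterSr; apply: (low_coef_alpha 1).
  by exists (alphaV b); rewrite // /L /=; exists k.+1; rewrite iterSr alphaVK.
have [L0|LT] := simple L idL alphaL.
  by case: a0; have : L a by [exists 0%N]; rewrite L0.
have : L 1 by rewrite LT.
by case=> k; rewrite iter_rmorph1.
Qed.

(** An element tested by [low_coef k] spans k + 1 degrees, so k < n covers [n] coefficients. The
    lowest vanishes, and the rest is a shorter element. *)
Lemma low_coef_eq0 n q (c : nat -> A) :
  (forall k a, (k < n)%N -> low_coef k a -> a = 0) ->
  K (\sum_(0 <= i < n) iota (c i) * Y ^+ (q + i)) ->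
  forall i, (i < n)%N -> c i = 0.
Proof.
elim: n q c => // n IH q c L0; rewrite big_nat_recl // addn0.
under eq_bigr do rewrite -addSnnS.
move=> Kc; have c0 : c 0%N = 0.
  by apply: (L0 n) => //; exists q, (fun i => c i.+1).
case=> // i; rewrite ltnS; apply: (IH q.+1 (fun i => c i.+1)) => [k a kn|].
  by apply: L0; apply: ltnW.
by move: Kc; rewrite c0 rmorph0 mul0r add0r.
Qed.

(** Right multiplication by Y^n turns w into a polynomial in [Y]; regularity of the factors from X^i
    Y^i ensures that no nonzero coefficient is lost. *)
Lemma low_coef_neq0 w : K w -> w <> 0 -> exists n a, low_coef n a /\ a <> 0.
Proof.
have [_ _ _ KMr] := idK => Kw w0; apply: contrapT => noL.
have L0 n a : low_coef n a -> a = 0.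
  by move=> La; apply: contrapT => a0; apply: noL; exists n, a.
pose P i := \prod_(j < i) iter j alphaV u.
have [n [a [b ew]]] := gwa_span alphaK alphaVK W_gwa w.
(* The coefficient of Y^j in w Y^n. It is 0 at j = 0 because w has no term in X^n. *)
pose c j := if (j < n)%N then if j == 0%N then 0 else b (n - j)%N * P (n - j)%N
            else a (j - n)%N.
have c0 : forall j, (j < n + n)%N -> c j = 0.
  apply: (@low_coef_eq0 (n + n) 0) => [k d _|]; first exact: L0.
  have := KMr (Y ^+ n) _ Kw; rewrite ew mulrDl !mulr_suml addrC.
  congr (K _); rewrite [RHS](big_cat_nat (n := n)) ?leq_addr //=; congr (_ + _).
    rewrite big_nat_rev /=; case: n @c {ew} => [|n] c; first by rewrite !big_geq.
    rewrite [RHS]big_ltn // /c /= rmorph0 mul0r add0r big_nat [RHS]big_nat.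
    apply: eq_bigr => -[//|i] /= iN; rewrite (_ : (i.+1 < n.+1)%N); last by lia.
    rewrite add1n subSS -mulrA.
    have -> : Y ^+ n.+1 = Y ^+ (n.+1 - i.+1) * Y ^+ (0 + i.+1).
      by rewrite -exprD; congr (_ ^+ _); lia.
    by rewrite [X in _ * X]mulrA (XYn alphaK u_central rel) !mulrA -rmorphM.
  rewrite -[X in _ = \sum_(X <= _ < _) _]add0n big_addn addnK; apply: eq_bigr => i _.
  by rewrite /c ltnNge leq_addl addnK -mulrA -exprD.
apply: w0; rewrite ew big_nat big1 ?add0r => [|i iN].
  rewrite big_nat big1 // => i iN.
  have := c0 (n - i)%N; rewrite /c ifT; last by lia.
  rewrite ifF; last by lia.
  rewrite subKn; last by lia.
  have [_ rP] := regular_prod i.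
  move=> /(_ ltac:(lia)); rewrite -(mul0r (P i)) => /rP ->.
  by rewrite rmorph0 mul0r.
have := c0 (i + n)%N; rewrite /c ifF; last by lia.
by rewrite addnK => ->; [rewrite rmorph0 mul0r|lia].
Qed.

Lemma alpha_simple_expY : alpha_simple alpha ->
  (forall i, (0 < i)%N -> ~ inner (iter i alpha)) -> K <> [set 0] ->
  exists p, K (Y ^+ p).
Proof.
move=> simple outer K0; have [_ KD KMl KMr] := idK.
have [_ _ Ya _] := rel; have [nz _] := simple.
have [w [Kw w0]] : exists w, K w /\ w <> 0.
  apply: contrapT => noK; apply: K0; apply/seteqP; split=> [w Kw|_ ->].
    by apply: contrapT => w0; apply: noK; exists w.
  by case: idK.
have exL : exists n, `[< exists a, low_coef n a /\ a <> 0 >].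
  by have [n La] := low_coef_neq0 Kw w0; exists n; apply/asboolP.
case: (ex_minnP exL) => n /asboolP[a [La a0]] minn {exL w Kw w0}.
have L0 k b : (k < n)%N -> low_coef k b -> b = 0.
  move=> kn Lb; apply: contrapT => b0.
  suff : (n <= k)%N by rewrite leqNgt kn.
  by apply: minn; apply/asboolP; exists b.
have [p [c]] := low_coef1 simple La a0; rewrite rmorph1 mul1r => Kc.
case: n => [|n] in minn L0 La Kc *.
  by exists p; move: Kc; rewrite big_geq // addr0.
(* With w = Y^p + ..., the element r w - w alpha^(-p)(r) of [K] loses its lowest term, so by
   minimality all its coefficients vanish. *)
have comm r j : (j < n.+1)%N -> r * c j = c j * iter j.+1 alpha r.
  move=> lt_jn; apply/subr0_eq.
  pose f i := r * c i - c i * iter i.+1 alpha r.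
  apply: (@low_coef_eq0 n.+1 p.+1 f) lt_jn => //.
  have := idealB idK (KMl (iota r) _ Kc) (KMr (iota (iter p alphaV r)) _ Kc).
  rewrite mulrDr mulrDl (Yn_iota rel) (iter_can _ alphaVK) opprD addrACA subrr add0r.
  rewrite mulr_sumr mulr_suml -sumrB; congr (K _); apply: eq_bigr => i _.
  rewrite -mulrA (Yn_iota rel) addSnnS addnC iterD (iter_can _ alphaVK).
  by rewrite !mulrA -!rmorphM -mulrBl -rmorphB.
(* The same argument applied to Y w - w Y. *)
have fixc : alpha (c n) = c n.
  apply/subr0_eq.
  apply: (@low_coef_eq0 n.+1 p.+2 (fun i => alpha (c i) - c i)) (ltnSn n) => //.
  have := idealB idK (KMl Y _ Kc) (KMr Y _ Kc).
  rewrite mulrDr mulrDl -exprS -exprSr opprD addrACA subrr add0r.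
  rewrite mulr_sumr mulr_suml -sumrB; congr (K _); apply: eq_bigr => i _.
  by rewrite mulrA Ya -!mulrA -exprS -exprSr -addSn rmorphB mulrBl.
set e := c n in fixc.
have {}comm r : r * e = e * iter n.+1 alpha r by apply: comm.
(* A zero top coefficient would put 1 in [low_coef n], against minimality. *)
have e0 : e <> 0.
  rewrite /e => e0; apply: nz; apply: (L0 n) => //; exists p, c.
  by move: Kc; rewrite big_nat_recr //= e0 rmorph0 mul0r addr0 rmorph1 mul1r.
(* The left ideal A e is two-sided by [comm] and alpha-stable by [fixc], so it is [A] and e has a
   left inverse. *)
pose I : set A := [set x | exists s, x = s * e].
have idI : ideal I.
  split.
  - by exists 0; rewrite mul0r.
  - by move=> _ _ [s ->] [t ->]; exists (s + t); rewrite mulrDl.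
  - by move=> r _ [s ->]; exists (r * s); rewrite mulrA.
  - move=> r _ [s ->]; exists (s * iter n.+1 alphaV r).
    by rewrite -!mulrA comm (iter_can _ alphaVK).
have alphaI : alpha @` I = I.
  apply/seteqP; split=> [_ [_ [s ->] <-]|_ [s ->]].
    by exists (alpha s); rewrite rmorphM fixc.
  by exists (alphaV s * e); [exists (alphaV s)|rewrite rmorphM alphaVK fixc].
have [I0|IT] := simple.2 I idI alphaI.
  by case: e0; have : I e by [exists 1; rewrite mul1r]; rewrite I0.
have [s es] : I 1 by rewrite IT.
case: (outer n.+1) => //; exists s, e.
(* By [comm], e alpha^(n+1)(s) = s e = 1, so e is a unit. *)
have [t et] : exists t, e * t = 1 by exists (iter n.+1 alpha s); rewrite -comm.
have st : s = t by rewrite -[LHS]mulr1 -et mulrA -es mul1r.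
rewrite -st in et.
by split=> // r; rewrite -mulrA comm mulrA -es mul1r.
Qed.

End AlphaSimple.

(** * Uniqueness of J(M) among prime ideals *)

Theorem theorem3p13
  (A : pzRingType) (alpha : {rmorphism A -> A}) (alphaV : A -> A)
  (alphaK : cancel alpha alphaV) (alphaVK : cancel alphaV alpha)
  (u : A) (u_central : central u) (u_regular : regular u)
  (W : pzRingType) (iota : {rmorphism A -> W}) (X Y : W)
  (W_gwa : is_gwa alpha alphaV u iota X Y)
  (m : nat) (m_gt0 : (0 < m)%N)
  (comaximal : forall i : nat, (0 < i)%N -> i <> m ->
     lspan2 u (iter i alpha u) = setT)
  (M : set A) (defM : M = lspan2 u (iter m alpha u))
  (M_maximal : maximal_ideal M) :
  let J := J_ideal alphaV iota X Y m M in
  [/\ maximal_ideal J /\ J (X ^+ m) /\ J (Y ^+ m),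
      (forall P : set W,
         (prime_ideal P /\ exists r : nat, [/\ (0 < r)%N, P (X ^+ r) & P (Y ^+ r)])
         <-> P = J) &
      alpha_simple alpha ->
      (forall i : nat, (0 < i)%N -> ~ inner (iter i alpha)) ->
      forall P : set W, (prime_ideal P /\ P <> [set 0]) <-> P = J].
Proof.
have [alphaV' EV] := rmorph_inverse alphaK alphaVK.
subst alphaV M => J.
have JX_m : J (X ^+ m) by apply: J_expX.
have JY_m : J (Y ^+ m) by apply: J_expY.
have J_max : maximal_ideal J.
  exact: (J_maximal alphaK alphaVK u_central W_gwa m_gt0 comaximal M_maximal).
have J_prime := maximal_prime J_max; have [_ JT maxJ] := J_max.
have unique (P : set W) r s :
    prime_ideal P -> P (X ^+ r) -> P (Y ^+ s) -> P = J.
  move=> [idP PT _] PX PY; have sJP : J `<=` P.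
    exact: (J_sub alphaK alphaVK u_central W_gwa m_gt0 comaximal idP PX PY).
  by case: (maxJ P idP sJP).
split=> // [P|simple outer P]; split=> [[P_prime]|->].
- by case=> r [_ PX PY]; apply: unique PX PY.
- by split=> //; exists m.
- move=> P0; have [idP _ _] := P_prime.
  have [s PY] := alpha_simple_expY alphaK alphaVK u_central u_regular W_gwa
    idP simple outer P0.
  (* The power of [X] comes from the algebra with [X] and [Y] exchanged; its hypotheses on the
     inverse of alpha follow from those on alpha. *)
  have au_central := central_can alphaVK u_central.
  have au_regular := regular_can alphaK alphaVK u_regular.
  have W_gwaV := is_gwa_sym alphaK W_gwa.
  have simpleV : alpha_simple alphaV'.
    case: simple => nz simple; split=> // I idI alphaVI; apply: simple => //.
    rewrite -[in LHS]alphaVI; apply/seteqP; split=> [_ [_ [a Ia <-] <-]|a Ia].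
      by rewrite alphaVK.
    by exists (alphaV' a); rewrite ?alphaVK //; exists a.
  have outerV i : (0 < i)%N -> ~ inner (iter i alphaV').
    move=> i_gt0 [c [d [cd dc e]]]; apply: (outer i i_gt0); exists d, c.
    split=> // a; rewrite -[in RHS](iter_can i alphaK a) e !mulrA dc mul1r.
    by rewrite -mulrA dc mulr1.
  have [r PX] := alpha_simple_expY alphaVK alphaK au_central au_regular W_gwaV
    idP simpleV outerV P0.
  exact: unique PX PY.
(* If [J] were 0, then X^m Y^m = 0. As [iota] is injective, a product of regular elements of [A]
   would vanish, forcing 1 = 0. *)
- split=> // J0; have [c0 [_ c0a _ _]] := gwa_degree0 alphaK alphaVK u_central W_gwa.
  case: simple => nz _; apply: nz.
  have XmYm : X ^+ m * Y ^+ m = 0.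
    by move: JX_m; rewrite J0 => ->; rewrite mul0r.
  have prod0 : \prod_(j < m) iter j alphaV' u = 0.
    rewrite -[LHS]c0a -(XYn alphaK u_central W_gwa.1) XmYm.
    by rewrite -(rmorph0 iota) c0a.
  have [_ rP] := regular_prod alphaK alphaVK u_regular m.
  by apply: rP; rewrite prod0 !mulr0.
Qed.
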